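(* For all integers $n \ge 1$ and $k \ge 0$, $$\Delta\, \mathcal{B}_{n,k}(q,y,z) = \widehat{\mathcal{B}}_{n,k}(q,y-1,z-1),$$ where $\Delta$ acts on the coefficients in $\mathcal{G}_{n,k}$ (i.e. $\Delta$ is extended $\mathbb{C}[q,y,z]$-linearly), with all objects as defined in the context.
   Context: Let $\Gamma_{n,k}$ be the set of directed graphs with vertices $1,\dots,n$ and $k$ numbered edges, i.e. sequences $G=([a_1,b_1],\dots,[a_k,b_k])$ with $a_i,b_i\in\{1,\dots,n\}$ (loops $[a,a]$ and repeated edges allowed). Let $\mathcal{G}_{n,k}$ be the complex vector space with basis $\Gamma_{n,k}$. For $G\in\Gamma_{n,k}$ the Bernardi polynomial is $B_G(q,y,z)=\sum_{f:\{1,\dots,n\}\to\{1,\dots,q\}} y^{\#f^{>}_G} z^{\#f^{<}_G}$, where $f^{>}_G$ (resp. $f^{<}_G$) is the set of edges $[a,b]$ of $G$ with $f(b)>f(a)$ (resp. $f(b)<f(a)$); this is a polynomial in $q,y,z$. For a polynomial $P\in\mathbb{C}[q,y,z]$, $[P]_k$ denotes the sum of those terms of $P$ whose monomial $q^s y^i z^j$ satisfies $i+j=k$ (any $s$). Define $$\mathcal{B}_{n,k}(q,y,z)=\sum_{G\in\Gamma_{n,k}} B_G(q,y,z)\,G,\qquad \widehat{\mathcal{B}}_{n,k}(q,y,z)=\sum_{G\in\Gamma_{n,k}} [B_G]_k(q,y,z)\,G,$$ elements of $\mathcal{G}_{n,k}[q,y,z]$. For $i\in\{1,\dots,k\}$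 and $p,r\in\{1,\dots,n\}$ let $R_{p,r;i}:\Gamma_{n,k}\to\Gamma_{n,k}$ replace the $i$-th edge of a graph by the edge $[p,r]$ (keeping number $i$). Let $B_i:\mathcal{G}_{n,k}\to\mathcal{G}_{n,k}$ be the linear operator defined on $G\in\Gamma_{n,k}$ whose $i$-th edge is $[a,b]$ by $B_i(G)=G$ if $a\neq b$, and $B_i(G)=-\sum_{m\neq a} R_{a,m;i}G$ if $a=b$ (sum over $m\in\{1,\dots,n\}\setminus\{a\}$). The Laplace operator is $\Delta=B_1B_2\cdots B_k$. *)

(* Defs.v *)
From HB Require Import structures.
From mathcomp Require Import all_boot all_order all_algebra.
From mathcomp Require Import reals complex.
From mathcomp Require Import mpoly.
Set Implicit Arguments.
Unset Strict Implicit.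
Unset Printing Implicit Defensive.
Import Order.TTheory GRing.Theory Num.Theory.
Local Open Scope ring_scope.

(* The vertices 1, ..., n are encoded by 'I_n, and the edges are numbered by
   'I_k; only the relative order of the labels matters. *)
Definition digraph (n k : nat) : finType := k.-tuple ('I_n * 'I_n).

Definition replace_edge (n k : nat) (p r : 'I_n) (i : 'I_k)
    (G : digraph n k) : digraph n k :=
  [tuple if j == i then (p, r) else tnth G j | j < k].

(* Polynomials in q, y, z. *)
Definition iq : 'I_3 := @Ordinal 3 0 isT.
Definition iy : 'I_3 := @Ordinal 3 1 isT.
Definition iz : 'I_3 := @Ordinal 3 2 isT.

Section Bernardi.
Variable K : numFieldType.

(* P(Q, y, z) *)
Definition spec_q (Q : nat) (P : {mpoly K[3]}) : {mpoly K[3]} :=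
  P \mPo [tuple Q%:R%:MP; 'X_iy; 'X_iz].

(* P(q, y - 1, z - 1) *)
Definition shift_yz (P : {mpoly K[3]}) : {mpoly K[3]} :=
  P \mPo [tuple 'X_iq; 'X_iy - 1; 'X_iz - 1].

(* [P]_k *)
Definition yz_part (k : nat) (P : {mpoly K[3]}) : {mpoly K[3]} :=
  \sum_(m <- msupp P | (m iy + m iz == k)%N) P@_m *: 'X_[m].

Section Graphs.
Variables n k : nat.
Implicit Type G : digraph n k.

(* Edges are counted with multiplicity, so the sets below are sets of edge
   numbers. *)
Definition ascents G (Q : nat) (f : {ffun 'I_n -> 'I_Q}) : {set 'I_k} :=
  [set j | (f (tnth G j).1 < f (tnth G j).2)%N].
Definition descents G (Q : nat) (f : {ffun 'I_n -> 'I_Q}) : {set 'I_k} :=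
  [set j | (f (tnth G j).2 < f (tnth G j).1)%N].

Definition bernardi_sum G (Q : nat) : {mpoly K[3]} :=
  \sum_(f : {ffun 'I_n -> 'I_Q})
    'X_iy ^+ #|ascents G f| * 'X_iz ^+ #|descents G f|.

Definition is_bernardi G (P : {mpoly K[3]}) : Prop :=
  forall Q : nat, spec_q Q P = bernardi_sum G Q.

Definition binom_q (m : nat) : {mpoly K[3]} :=
  (m`!%:R^-1 : K) *: \prod_(i < m) ('X_iq - i%:R).

Lemma spec_q_binom Q m : spec_q Q (binom_q m) = 'C(Q, m)%:R.
Proof.
rewrite /spec_q /binom_q comp_mpolyZ rmorph_prod /=.
have -> : \prod_(i < m) (('X_iq - i%:R) \mPo
    [tuple Q%:R%:MP; 'X_iy; 'X_iz]) = (Q ^_ m)%:R :> {mpoly K[3]}.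
  rewrite (eq_bigr (fun i : 'I_m => Q%:R - i%:R)); last first.
    by move=> i _; rewrite rmorphB /= rmorph_nat comp_mpolyXU /= rmorph_nat.
  have [leQm|ltmQ] := leqP m Q.
    rewrite ffact_prod natr_prod; apply: eq_bigr => i _.
    by rewrite natrB // ltnW // (leq_trans _ leQm).
  by rewrite ffact_small // (bigD1 (Ordinal ltmQ)) //= subrr mul0r.
rewrite -bin_ffact natrM -mul_mpolyC -[m`!%:R in X in _ * X](rmorph_nat (@mpolyC 3 K)).
rewrite mulrCA -mpolyCM mulVf ?mpolyC1 ?mulr1 //.
by rewrite pnatr_eq0 -lt0n fact_gt0.
Qed.

Definition surj_sum G (m : nat) : {mpoly K[3]} :=
  \sum_(g : {ffun 'I_n -> 'I_m} | g @: setT == setT)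
    'X_iy ^+ #|ascents G g| * 'X_iz ^+ #|descents G g|.

Lemma enum_val_lt Q (A : {set 'I_Q}) (x y : 'I_#|A|) :
  (enum_val x < enum_val y)%N = (x < y)%N.
Proof.
have mono (u v : 'I_#|A|) : (u < v)%N -> (enum_val u < enum_val v)%N.
  move=> ltuv; pose z0 := enum_val u.
  have srt : sorted (fun a b : 'I_Q => (a < b)%N) (enum A).
    rewrite {1}/enum_mem; apply: sorted_filter => [a b c|]; first exact: ltn_trans.
    have := iota_ltn_sorted 0 Q; rewrite -val_enum_ord sorted_map enumT.
    by [].
  rewrite !(enum_val_nth z0).
  apply: (sorted_ltn_nth _ z0 srt) => //; rewrite ?inE -?cardE //.
  by move=> a b c; exact: ltn_trans.
apply/idP/idP; last exact: mono.
case: (ltngtP x y) => //.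
  by move/mono=> h1 h2; have := ltn_trans h1 h2; rewrite ltnn.
by move/val_inj=> ->; rewrite ltnn.
Qed.

Lemma image_sum G Q (A : {set 'I_Q}) :
  \sum_(f : {ffun 'I_n -> 'I_Q} | f @: setT == A)
    'X_iy ^+ #|ascents G f| * 'X_iz ^+ #|descents G f| = surj_sum G #|A|.
Proof.
rewrite /surj_sum.
pose h (g : {ffun 'I_n -> 'I_#|A|}) : {ffun 'I_n -> 'I_Q} :=
  [ffun a => enum_val (g a)].
have hI : injective h.
  by move=> g1 g2 /ffunP e; apply/ffunP=> a; have := e a; rewrite !ffunE => /enum_val_inj.
have imh g : h g @: setT = @enum_val _ _ @: (g @: setT).
  by rewrite -imset_comp; apply: eq_imset => a; rewrite /= ffunE.
have hs : [set f : {ffun 'I_n -> 'I_Q} | f @: setT == A] =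
    h @: [set g : {ffun 'I_n -> 'I_#|A|} | g @: setT == setT].
  apply/setP=> f; rewrite inE; apply/eqP/imsetP => [fA|[g]]; last first.
    rewrite inE => /eqP sg ->; rewrite imh sg; apply/setP=> x.
    apply/imsetP/idP => [[u _ ->]|xA]; first exact: enum_valP.
    by exists (enum_rank_in xA x) => //; rewrite enum_rankK_in.
  have fin a : f a \in A by rewrite -fA imset_f.
  pose g : {ffun 'I_n -> 'I_#|A|} := [ffun a => enum_rank_in (fin a) (f a)].
  have fg : f = h g by apply/ffunP=> a; rewrite !ffunE enum_rankK_in.
  exists g => //; rewrite inE; apply/eqP/setP=> u; rewrite inE.
  have : enum_val u \in f @: setT by rewrite fA enum_valP.
  case/imsetP=> a _; rewrite fg ffunE => /enum_val_inj ->.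
  by rewrite imset_f.
rewrite -big_set hs big_imset /=; last by move=> ? ? _ _; exact: hI.
rewrite big_set; apply: eq_bigr => g _; congr ('X_iy ^+ _ * 'X_iz ^+ _).
  by apply: eq_card => j; rewrite !inE !ffunE enum_val_lt.
by apply: eq_card => j; rewrite !inE !ffunE enum_val_lt.
Qed.

Lemma spec_q_surj_sum Q G m : spec_q Q (surj_sum G m) = surj_sum G m.
Proof.
rewrite /spec_q rmorph_sum /=; apply: eq_bigr => g _.
by rewrite rmorphM !rmorphXn /= !comp_mpolyXU.
Qed.

Lemma bernardi_exists G : {P : {mpoly K[3]} | is_bernardi G P}.
Proof.
exists (\sum_(m < n.+1) binom_q m * surj_sum G m) => Q.
have -> : spec_q Q (\sum_(m < n.+1) binom_q m * surj_sum G m) =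
    \sum_(m < n.+1) 'C(Q, m)%:R * surj_sum G m.
  rewrite {1}/spec_q rmorph_sum /=; apply: eq_bigr => m _.
  by rewrite rmorphM /= -!/(spec_q Q _) spec_q_binom spec_q_surj_sum.
rewrite /bernardi_sum.
rewrite (partition_big (fun f : {ffun 'I_n -> 'I_Q} =>
    inord #|f @: setT| : 'I_n.+1) xpredT) //=.
apply: eq_bigr => m _; have card_im (f : {ffun 'I_n -> 'I_Q}) :
    (inord #|f @: setT| == m) = (#|f @: setT| == m).
  rewrite -val_eqE /= inordK // ltnS (leq_trans (leq_imset_card _ _)) //.
  by rewrite cardsT card_ord.
rewrite (eq_bigl _ _ card_im).
rewrite (partition_big (fun f : {ffun 'I_n -> 'I_Q} => f @: setT)
   (fun A : {set 'I_Q} => #|A| == m)) //=.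
rewrite (eq_bigr (fun A => surj_sum G m)); last first.
  move=> A /eqP Am; rewrite -[in RHS]Am -image_sum; apply: eq_bigl => f.
  by case: (f @: setT =P A) => [->|_]; rewrite ?Am ?eqxx ?andbT ?andbF.
rewrite sumr_const mulr_natl; congr (_ *+ _).
rewrite -[Q in LHS]card_ord -cardsT -cards_draws; apply: eq_card => A.
by rewrite !inE subsetT.
Qed.

Lemma bernardi_unique G (P1 P2 : {mpoly K[3]}) :
  is_bernardi G P1 -> is_bernardi G P2 -> P1 = P2.
Proof.
move=> h1 h2; apply/eqP; rewrite -subr_eq0; apply/eqP.
set P := P1 - P2.
have {h1 h2}P0 Q : spec_q Q P = 0.
  by rewrite /spec_q /P raddfB /= -!/(spec_q Q _) h1 h2 subrr.
apply/mpolyP=> m; rewrite mcoeff0.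
pose p : {poly K} := \sum_(u <- msupp P | (u iy == m iy) && (u iz == m iz))
   P@_u *: 'X^(u iq).
have coefp s : p`_s = \sum_(u <- msupp P |
    (u iy == m iy) && (u iz == m iz)) P@_u *+ (s == u iq).
  rewrite coef_sum; apply: eq_bigr => u _.
  by rewrite coefZ coefXn mulr_natr.
have p0 : p = 0.
  apply/eqP/negPn/negP => /(@max_poly_roots _ p
     [seq i%:R | i <- iota 0 (size p)]).
  rewrite size_map size_iota ltnn map_inj_uniq ?iota_uniq; last first.
    by move=> i j /eqP; rewrite eqr_nat => /eqP.
  move=> H; suff: false by []. apply: H => //.
  apply/allP=> _ /mapP[Q _ ->]; apply/rootP.
  pose w : 'X_{1..3} := [multinom (if i == iq then 0 else m i)%N | i < 3].
  have := congr1 (mcoeff w) (P0 Q); rewrite mcoeff0 /spec_q comp_mpolyEX.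
  rewrite raddf_sum /= => <-; rewrite /p horner_sum big_mkcond /=.
  apply: eq_bigr => u _; rewrite hornerZ hornerXn comp_mpolyX.
  rewrite 3!big_ord_recl big_ord0 mulr1 /= !(tnth_nth 0) /=.
  have -> : lift ord0 (ord0 : 'I_2) = iy by apply: val_inj.
  have -> : lift ord0 (lift ord0 (ord0 : 'I_1)) = iz by apply: val_inj.
  have -> : (ord0 : 'I_3) = iq by apply: val_inj.
  rewrite !mpolyXn -mpolyXD -(rmorphXn (@mpolyC 3 K)) mul_mpolyC !mcoeffZ mcoeffX.
  have -> : ((U_( iy) *+ u iy + U_( iz) *+ u iz)%MM == w) =
     (u iy == m iy) && (u iz == m iz).
    apply/eqP/andP => [e|[/eqP e1 /eqP e2]].
      have := congr1 (fun v : 'X_{1..3} => v iy) e.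
      have := congr1 (fun v : 'X_{1..3} => v iz) e.
      rewrite /w !mnmDE !mulmnE !mnm1E !mnmE -!val_eqE /= => <- <-.
      by rewrite !mul0n !mul1n addn0 add0n !eqxx.
    apply/mnmP=> i; rewrite /w mnmDE !mulmnE !mnm1E mnmE.
    case: i => -[|[|[|//]]] hi.
    - by rewrite -!val_eqE.
    - rewrite -!val_eqE /= e1 mul0n addn0 mul1n.
      by congr (m _); apply: val_inj.
    rewrite -!val_eqE /= e2 mul0n add0n mul1n.
    by congr (m _); apply: val_inj.
  by case: ifP => _; rewrite ?mulr1 ?mulr0 // -natrX.
have := coefp (m iq); rewrite p0 coef0 => H.
case mP: (m \in msupp P); last by apply: memN_msupp_eq0; rewrite mP.
move: H; rewrite (big_rem m) //= !eqxx /= mulr1n big1_seq ?addr0 // => u.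
rewrite mem_rem_uniq ?msupp_uniq // inE => /andP[/andP[/eqP e1 /eqP e2]].
case/andP=> ne _; case: eqP => // e0; case/eqP: ne; apply/mnmP.
case=> -[|[|[|//]]] hi.
- by have -> : Ordinal hi = iq by apply: val_inj.
- by have -> : Ordinal hi = iy by apply: val_inj.
by have -> : Ordinal hi = iz by apply: val_inj.
Qed.

(* The polynomial B_G(q, y, z), characterized by its values at q = Q. *)
Definition bernardi G : {mpoly K[3]} := sval (bernardi_exists G).

Lemma bernardiP G : is_bernardi G (bernardi G).
Proof. exact: svalP. Qed.

(* The vector space with basis digraph n k, its basis, and its extension
   of scalars to K[q, y, z]; elements are given by their coordinates. *)
Local Notation gspace := {ffun digraph n k -> K^o}.
Local Notation gspace_poly := {ffun digraph n k -> {mpoly K[3]}}.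

Definition gbasis G : gspace := [ffun H => (H == G)%:R].

Definition bernardi_vec : gspace_poly := [ffun G => bernardi G].

Definition bernardi_hat_vec : gspace_poly := [ffun G => yz_part k (bernardi G)].

Definition shift_yz_vec (v : gspace_poly) : gspace_poly :=
  [ffun G => shift_yz (v G)].

Definition B_on_basis (i : 'I_k) G : gspace :=
  let: (a, b) := tnth G i in
  if a != b then gbasis G
  else - \sum_(m : 'I_n | m != a) gbasis (replace_edge a m i G).

Definition B_op (i : 'I_k) (v : gspace) : gspace :=
  \sum_G v G *: B_on_basis i G.

Definition laplace (v : gspace) : gspace := foldr B_op v (enum 'I_k).

(* The K[q, y, z]-linear extension of an operator on gspace. *)
Definition extend_scalars (T : gspace -> gspace) (v : gspace_poly) :
    gspace_poly :=
  [ffun H => \sum_G T (gbasis G) H *: v G].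

Lemma B_op_basis i G : B_op i (gbasis G) = B_on_basis i G.
Proof.
rewrite /B_op (bigD1 G) //= big1 ?addr0 => [|H /negPf HG]; rewrite ffunE.
  by rewrite eqxx scale1r.
by rewrite HG scale0r.
Qed.

Lemma laplace_linear c (u v : gspace) :
  laplace (c *: u + v) = c *: laplace u + laplace v.
Proof.
have Blin i (x y : gspace) : B_op i (c *: x + y) = c *: B_op i x + B_op i y.
  rewrite /B_op scaler_sumr -big_split /=; apply: eq_bigr => G _.
  by rewrite !ffunE scalerDl scalerA.
by rewrite /laplace; elim: (enum 'I_k) => //= i s ->.
Qed.

Lemma gbasis_sum (v : gspace) : v = \sum_G v G *: gbasis G.
Proof.
apply/ffunP=> H; rewrite sum_ffunE (bigD1 H) //= !ffunE eqxx.
rewrite [X in _ *: X]mulr1n big1 ?addr0 => [|G /negPf GH]; first by rewrite [RHS]mulr1.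
by rewrite !ffunE eq_sym GH [LHS]mulr0.
Qed.

(* extend_scalars laplace is laplace acting on the coefficient of each
   monomial. *)
Lemma extend_laplace_coef (v : gspace_poly) (m : 'X_{1..3}) H :
  (extend_scalars laplace v H)@_m =
  laplace ([ffun G => (v G)@_m] : gspace) H.
Proof.
set w : gspace := finfun _.
have lap0 : laplace 0 = 0.
  have := laplace_linear (-1) 0 0.
  by rewrite scaler0 addr0 scaleN1r addNr.
have lapS (s : seq (digraph n k)) : laplace (\sum_(G <- s) w G *: gbasis G) =
    \sum_(G <- s) w G *: laplace (gbasis G).
  by elim: s => [|G s IH]; rewrite ?big_nil // !big_cons laplace_linear IH.
rewrite [in RHS](gbasis_sum w) lapS sum_ffunE ffunE raddf_sum /=.
by apply: eq_bigr => G _; rewrite mcoeffZ !ffunE [RHS]mulrC.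
Qed.

End Graphs.
End Bernardi.

(* Main.v *)
Require Import Defs.
From HB Require Import structures.
From mathcomp Require Import all_boot all_order all_algebra.
From mathcomp Require Import reals complex.
From mathcomp Require Import mpoly.
Local Open Scope ring_scope.

(** At [q = Q] the Bernardi polynomial is a sum, over colourings [f], of products
over the edges of [G] of a weight [w] equal to [y], [z] or [1].  The Laplace
operator also factors over the edges, and on one edge it sends
[\sum_e w(e) e] to [\sum_[a,b] (w(a,b) - w(a,a)) [a,b]], where [w(a,a) = 1].  So
the strict weights become [y - 1] and [z - 1], and an edge on which [f] is
constant kills the product, which leaves the colourings that are strict on
all [k] edges: these are the ones selected by [[.]_k]. *)

Set Implicit Arguments.
Unset Strict Implicit.
Unset Printing Implicit Defensive.
Import GRing.Theory.

(** * Sums and products indexed by edges *)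

Lemma sum_tuple_prod (R : comPzSemiRingType) (E : finType) k
    (F : 'I_k -> E -> R) :
  \sum_(t : k.-tuple E) \prod_i F i (tnth t i) = \prod_i \sum_e F i e.
Proof.
rewrite bigA_distr_bigA /=.
rewrite (reindex (fun t : k.-tuple E => [ffun i => tnth t i])) /=.
  by apply: eq_bigr => t _; apply: eq_bigr => i _; rewrite ffunE.
exists (fun f : {ffun 'I_k -> E} => [tuple f i | i < k]) => [t _|f _].
  by apply: eq_from_tnth => i; rewrite tnth_mktuple ffunE.
by apply/ffunP=> i; rewrite ffunE tnth_mktuple.
Qed.

(** Disjointness keeps the subtraction from truncating: [#|A| + #|B|] is the size of the union, so
    the last exponent counts its complement. *)
Lemma prod_if_disjoint (R : comPzSemiRingType) (I : finType) (A B : {set I})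
    (a b c : R) : [disjoint A & B] ->
  \prod_i (if i \in A then a else if i \in B then b else c) =
  a ^+ #|A| * b ^+ #|B| * c ^+ (#|I| - (#|A| + #|B|)).
Proof.
move=> dAB; rewrite (bigID (mem A)) /= -mulrA; congr (_ * _).
  by rewrite (eq_bigr (fun=> a)) ?prodr_const // => i ->.
rewrite (bigID (mem B)) /=; congr (_ * _).
  rewrite (eq_bigr (fun=> b)) => [|i /andP[/negPf-> ->]] //.
  rewrite prodr_const; congr (_ ^+ _); apply: eq_card => i.
  rewrite unfold_in /=; case: (boolP (i \in A)) => // iA.
  by rewrite (disjointFr dAB iA).
rewrite (eq_bigr (fun=> c)) => [|i /andP[/negPf-> /negPf->]] //.
rewrite prodr_const; congr (_ ^+ _).
have -> : (#|A| + #|B|)%N = #|A :|: B|.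
  by apply/esym/eqP; rewrite (leq_card_setU A B).
rewrite -[A :|: B]setCK -cardsCs; apply: eq_card => i.
by rewrite unfold_in !inE negb_or.
Qed.

(** * The Laplace operator as a tensor product over the edges *)

Section Laplace.
Variables (K : numFieldType) (n k : nat).
Local Notation edge := ('I_n * 'I_n)%type.
Implicit Types (G H : digraph n k) (e : edge).

(** Matrix of [B_op] on a single edge: the coefficient of [e'] in the image of [e]. *)
Definition edge_laplace e e' : K :=
  if e.1 != e.2 then (e' == e)%:R
  else - ((e'.1 == e.1) && (e'.2 != e.1))%:R.

(** Two edges contribute to a non-loop [[a,b]]: itself, and the loop [[a,a]] with sign [-1]. No
    image contains a loop. Weights lie in a [K]-module so that they can be polynomials. *)
Lemma edge_laplace_sum (V : lmodType K) (w : edge -> V) e' :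
  \sum_e edge_laplace e e' *: w e =
  if e'.1 == e'.2 then 0 else w e' - w (e'.1, e'.1).
Proof.
case: e' => a b /=; rewrite (bigID (fun e => e.1 != e.2)) /=.
rewrite (eq_bigr (fun e => if e == (a, b) then w e else 0)); last first.
  move=> e ne; rewrite /edge_laplace ne eq_sym.
  by case: eqP => _; rewrite ?scale1r ?scale0r.
rewrite -big_mkcondr /=.
rewrite [X in _ + X](eq_bigr (fun e =>
  if (e.1 == a) && (b != a) then - w e else 0)); last first.
  move=> e /negPf ne; rewrite /edge_laplace ne /= eq_sym.
  by case: (e.1 =P a) => [->|_]; case: (b != a);
     rewrite ?scaleN1r // ?oppr0 ?scale0r.
rewrite -big_mkcondr /=; have [<-|ab] := eqVneq a b.
  rewrite big1 => [|e /andP[ne /eqP def_e]]; last by rewrite def_e eqxx in ne.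
  by rewrite add0r big1 // => e; rewrite !andbF.
congr (_ + _).
  rewrite (big_pred1 (a, b)) // => -[c d]; rewrite /= xpair_eqE andb_idl //.
  by case/andP=> /eqP-> /eqP->.
rewrite (big_pred1 (a, a)) // => -[c d]; rewrite /= andbT negbK xpair_eqE.
by case: (c =P a) => [->|_]; rewrite ?andbF // andbT eq_sym.
Qed.

Lemma gbasisE G H : gbasis K G H = \prod_i (tnth H i == tnth G i)%:R.
Proof.
rewrite ffunE; have [->|ne] := eqVneq H G.
  by rewrite big1 // => i _; rewrite eqxx.
have [i ne_i] : exists i, tnth H i != tnth G i.
  apply/existsP; apply: contraNT ne => /existsPn eqHG.
  by apply/eqP/eq_from_tnth => i; apply/eqP/negbNE/eqHG.
by rewrite (bigD1 i) //= (negPf ne_i) mul0r.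
Qed.

(** With graphs seen as pure tensors of edges, the [i]-th operator acts on the [i]-th factor and is
    the identity on the others. *)
Lemma B_on_basisE i G H :
  B_on_basis K i G H = \prod_j
    (if j == i then edge_laplace (tnth G j) (tnth H j)
     else (tnth H j == tnth G j)%:R).
Proof.
rewrite (bigD1 i) //= eqxx (eq_bigr (fun j => (tnth H j == tnth G j)%:R)); last first.
  by move=> j /negPf->.
rewrite /B_on_basis; case Gi: (tnth G i) => [a b] /=.
rewrite /edge_laplace /=; case: ifP => _; first by rewrite gbasisE (bigD1 i) //= Gi.
rewrite ffunE sum_ffunE mulNr; congr (- _).
rewrite (eq_bigr (fun m => (tnth H i == (a, m))%:R *
   \prod_(j | j != i) (tnth H j == tnth G j)%:R)) => [|m _]; last first.
  rewrite gbasisE (bigD1 i) //= tnth_mktuple eqxx; congr (_ * _).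
  by apply: eq_bigr => j /negPf ji; rewrite tnth_mktuple ji.
(* Only the [i]-th factor depends on [m], and in its sum only [m = d] can contribute. *)
rewrite -mulr_suml; congr (_ * _); case: (tnth H i) => c d /=.
rewrite (eq_bigr (fun m => if m == d then (c == a)%:R else 0)); last first.
  by move=> m _; rewrite xpair_eqE [d == m]eq_sym; case: (m == d); rewrite ?andbT ?andbF.
rewrite -big_mkcondr /=; have [da|da] := eqVneq d a.
  by rewrite andbF big1 // => m /andP[ma /eqP md]; rewrite md da eqxx in ma.
rewrite andbT (big_pred1 d) // => m /=.
by case: (m =P d) => [->|_]; rewrite ?da ?andbF.
Qed.

(** Pure tensors stay pure tensors, so the operators can be composed factor by factor. *)
Lemma B_op_prod i (c : 'I_k -> edge -> K) :
  B_op i [ffun G : digraph n k => \prod_j c j (tnth G j) : K^o] =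
  [ffun H : digraph n k => \prod_j
    (if j == i then \sum_e c j e * edge_laplace e (tnth H j)
     else c j (tnth H j)) : K^o].
Proof.
apply/ffunP=> H; rewrite sum_ffunE ffunE.
transitivity (\sum_G \prod_j (c j (tnth G j) *
    (if j == i then edge_laplace (tnth G j) (tnth H j)
     else (tnth H j == tnth G j)%:R))).
  apply: eq_bigr => G _; rewrite !ffunE B_on_basisE.
  by rewrite [RHS]big_split.
rewrite (sum_tuple_prod (fun j e => c j e *
    (if j == i then edge_laplace e (tnth H j) else (tnth H j == e)%:R))).
apply: eq_bigr => j _; case: eqP => // _.
rewrite (bigD1 (tnth H j)) //= eqxx mulr1 big1 ?addr0 // => e /negPf.
by rewrite eq_sym => ->; rewrite mulr0.
Qed.

Lemma laplace_gbasis G H :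
  laplace (gbasis K G) H = \prod_i edge_laplace (tnth G i) (tnth H i).
Proof.
rewrite /laplace.
have foldrE (s : seq 'I_k) : uniq s -> foldr (@B_op K n k) (gbasis K G) s =
    [ffun H : digraph n k => \prod_j (if j \in s then
       edge_laplace (tnth G j) (tnth H j) else (tnth H j == tnth G j)%:R) : K^o].
  elim: s => [_|i s IH] /=; first by apply/ffunP=> H'; rewrite gbasisE ffunE.
  case/andP=> is_ /IH ->.
  rewrite (B_op_prod i (fun j e => if j \in s then
    edge_laplace (tnth G j) e else (e == tnth G j)%:R)).
  apply/ffunP=> H'; rewrite !ffunE; apply: eq_bigr => j _; rewrite inE.
  (* Since [i] is not in [s], its factor is still an indicator, and the sum reduces to one matrix
     entry. *)
  case: eqP => //= ->; rewrite (negPf is_).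
  rewrite (bigD1 (tnth G i)) //= eqxx mul1r big1 ?addr0 // => e /negPf->.
  by rewrite mul0r.
rewrite foldrE ?enum_uniq // ffunE; apply: eq_bigr => i _.
by rewrite mem_enum.
Qed.

End Laplace.

(** * Colourings as products of edge weights *)

Section Weights.
Variables (K : numFieldType) (n k : nat).
Implicit Types (G H : digraph n k) (P : {mpoly K[3]}).

(** [t] is the weight of an edge whose ends have equal colours: [1] in the Bernardi sum, [0] after
    the Laplace operator. *)
Definition strict_weight Q (f : {ffun 'I_n -> 'I_Q}) (u v t : {mpoly K[3]})
    (e : 'I_n * 'I_n) : {mpoly K[3]} :=
  if (f e.1 < f e.2)%N then u else if (f e.2 < f e.1)%N then v else t.

Lemma disjoint_asc_desc Q (f : {ffun 'I_n -> 'I_Q}) G :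
  [disjoint ascents G f & descents G f].
Proof.
rewrite disjoint_subset; apply/subsetP=> j; rewrite !inE => lt_ab.
by rewrite -leqNgt ltnW.
Qed.

Lemma prod_strict_weight Q (f : {ffun 'I_n -> 'I_Q}) G u v t :
  \prod_j strict_weight f u v t (tnth G j) =
  u ^+ #|ascents G f| * v ^+ #|descents G f| *
  t ^+ (k - (#|ascents G f| + #|descents G f|)).
Proof.
rewrite -[k in t ^+ (k - _)]card_ord -(prod_if_disjoint _ _ _ (disjoint_asc_desc f G)).
by apply: eq_bigr => j _; rewrite !inE.
Qed.

Lemma leq_asc_desc Q (f : {ffun 'I_n -> 'I_Q}) G :
  (#|ascents G f| + #|descents G f| <= k)%N.
Proof.
have /eqP <- : #|ascents G f :|: descents G f| == (#|ascents G f| + #|descents G f|)%N.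
  by rewrite (leq_card_setU _ _) disjoint_asc_desc.
by rewrite -[leqRHS]card_ord max_card.
Qed.

Lemma bernardi_sumE G Q :
  bernardi_sum K G Q = \sum_(f : {ffun 'I_n -> 'I_Q})
    \prod_j strict_weight f 'X_iy 'X_iz 1 (tnth G j).
Proof. by apply: eq_bigr => f _; rewrite prod_strict_weight expr1n mulr1. Qed.

Lemma laplace_bernardi_sum H Q :
  \sum_G laplace (gbasis K G) H *: bernardi_sum K G Q =
  \sum_(f : {ffun 'I_n -> 'I_Q})
    \prod_j strict_weight f ('X_iy - 1) ('X_iz - 1) 0 (tnth H j).
Proof.
under eq_bigr => G _ do rewrite bernardi_sumE laplace_gbasis scaler_sumr.
rewrite exchange_big /=; apply: eq_bigr => f _.
under eq_bigr => G _ do rewrite -scaler_prod.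
rewrite (sum_tuple_prod (fun j e => edge_laplace K e (tnth H j) *:
  strict_weight f 'X_iy 'X_iz 1 e)).
apply: eq_bigr => j _; rewrite edge_laplace_sum /strict_weight /= ltnn.
(* A loop gives [0] on both sides; distinct ends of equal colour give [1 - 1]. *)
by case: eqP => [->|_]; rewrite ?ltnn //; do 2?[case: ifP => // _]; rewrite subrr.
Qed.

End Weights.

(** * The part of degree [k] in [y] and [z], and the substitutions *)

Section YZPart.
Variable K : numFieldType.
Implicit Types (P : {mpoly K[3]}) (m : 'X_{1..3}).

(** Outside the support both sides vanish, so [m] is arbitrary; this exposes the linearity hidden by
    the sum over [msupp P]. *)
Lemma mcoeff_yz_part k P m :
  (yz_part k P)@_m = if (m iy + m iz == k)%N then P@_m else 0.
Proof.
rewrite /yz_part raddf_sum /= big_mkcond /=.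
rewrite (eq_bigr (fun u => if u == m then
    if (m iy + m iz == k)%N then P@_m else 0 else 0)); last first.
  move=> u _; rewrite mcoeffZ mcoeffX; case: (u =P m) => [->|_].
    by rewrite mulr1.
  by rewrite mulr0 if_same.
case mP: (m \in msupp P).
  by rewrite (bigD1_seq m) ?msupp_uniq //= eqxx big1 ?addr0 // => u /negPf->.
rewrite (memN_msupp_eq0 (negbT mP)) if_same big1 // => u _.
by rewrite if_same.
Qed.

Lemma yz_part_is_linear k : linear (@yz_part K k).
Proof.
move=> c P1 P2; apply/mpolyP=> m; rewrite linearP /= !mcoeff_yz_part linearP /=.
by case: eqP => // _; rewrite mulr0 addr0.
Qed.

HB.instance Definition _ k := GRing.isLinear.Build K {mpoly K[3]} {mpoly K[3]} _
  (@yz_part K k) (yz_part_is_linear k).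

Lemma yz_partX k m :
  yz_part k 'X_[m] = if (m iy + m iz == k)%N then 'X_[m] else 0 :> {mpoly K[3]}.
Proof.
apply/mpolyP=> u; rewrite mcoeff_yz_part (fun_if (mcoeff u)) mcoeff0 mcoeffX.
by case: (m =P u) => [->|_] //; rewrite !if_same.
Qed.

Lemma yz_part_yzX k a b :
  yz_part k ('X_iy ^+ a * 'X_iz ^+ b) =
  if (a + b == k)%N then 'X_iy ^+ a * 'X_iz ^+ b else 0 :> {mpoly K[3]}.
Proof.
rewrite !mpolyXn -mpolyXD yz_partX !mnmDE !mulmnE !mnm1E -!val_eqE /=.
by rewrite !mul0n !mul1n addn0 add0n.
Qed.

Lemma comp_mpoly3X (u v w : {mpoly K[3]}) m :
  'X_[m] \mPo [tuple u; v; w] = u ^+ m iq * v ^+ m iy * w ^+ m iz.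
Proof.
rewrite comp_mpolyX 3!big_ord_recl big_ord0 mulr1 /= mulrA.
by congr (_ ^+ m _ * _ ^+ m _ * _ ^+ m _); apply: val_inj.
Qed.

HB.instance Definition _ Q := GRing.LRMorphism.copy (@spec_q K Q)
  (comp_mpoly [tuple Q%:R%:MP; 'X_iy; 'X_iz]).

HB.instance Definition _ := GRing.LRMorphism.copy (@shift_yz K)
  (comp_mpoly [tuple 'X_iq; 'X_iy - 1; 'X_iz - 1]).

Lemma eq_linear_mpolyX n (V : lmodType K) (f g : {linear {mpoly K[n]} -> V}) :
  (forall m : 'X_{1..n}, f 'X_[m] = g 'X_[m]) -> f =1 g.
Proof.
move=> eq_fgX p; rewrite (mpolyE p) !linear_sum /=; apply: eq_bigr => m _.
by rewrite !linearZ /= eq_fgX.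
Qed.

Lemma spec_qX Q m :
  spec_q Q 'X_[m] = (Q ^ m iq)%:R *: ('X_iy ^+ m iy * 'X_iz ^+ m iz)
    :> {mpoly K[3]}.
Proof. by rewrite /spec_q comp_mpoly3X -mulrA -rmorphXn mul_mpolyC natrX. Qed.

(** On a monomial, putting [q = Q] leaves the exponents of [y] and [z] alone and turns the power of
    [q] into a scalar. *)
Lemma spec_q_yz_part Q k P : spec_q Q (yz_part k P) = yz_part k (spec_q Q P).
Proof.
apply: (eq_linear_mpolyX (f := spec_q Q \o yz_part k)
  (g := yz_part k \o spec_q Q)) => m /=.
rewrite yz_partX spec_qX linearZ /= yz_part_yzX.
by case: eqP => _; rewrite ?linear0 ?scaler0 // spec_qX.
Qed.

(** The two substitutions act on different variables. *)
Lemma spec_q_shift_yz Q P : spec_q Q (shift_yz P) = shift_yz (spec_q Q P).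
Proof.
apply: (eq_linear_mpolyX (f := spec_q Q \o @shift_yz K)
  (g := @shift_yz K \o spec_q Q)) => m /=.
rewrite spec_qX linearZ /= {1}/shift_yz comp_mpoly3X !rmorphM !rmorphXn !rmorphB !rmorph1 /=.
rewrite /spec_q /shift_yz !comp_mpolyXU /=.
by rewrite -rmorphXn -mulrA mul_mpolyC.
Qed.

(* [bernardi_unique] only compares two polynomials with the values of the same
   [B_G]; adding [P1 - P2] to [B_G] reduces the general case to it. *)
Lemma eq_spec_q P1 P2 : (forall Q, spec_q Q P1 = spec_q Q P2) -> P1 = P2.
Proof.
move=> eqP12; pose G : digraph 0 0 := [tuple].
have BP : is_bernardi G (bernardi K G + (P1 - P2)).
  move=> Q; rewrite linearD linearB /=.
  by rewrite bernardiP eqP12 subrr addr0.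
have /eqP := bernardi_unique BP (bernardiP K G).
by rewrite -subr_eq0 addrC addKr subr_eq0 => /eqP.
Qed.

Lemma shift_yz_part_bernardi_sum n k (H : digraph n k) Q :
  shift_yz (yz_part k (bernardi_sum K H Q)) =
  \sum_(f : {ffun 'I_n -> 'I_Q})
    \prod_j strict_weight f ('X_iy - 1) ('X_iz - 1) 0 (tnth H j).
Proof.
rewrite /bernardi_sum [yz_part _ _]linear_sum linear_sum /=; apply: eq_bigr => f _.
(* Let [s] be the number of strict edges. [0 ^+ (k - s)] is [1] exactly when [k <= s]; as [s <= k],
   this is the condition [s = k] imposed by [yz_part]. *)
rewrite prod_strict_weight yz_part_yzX expr0n subn_eq0 eqn_leq leq_asc_desc /=.
case: ifP => _; last by rewrite linear0 mulr0.
by rewrite mulr1 rmorphM !rmorphXn /= /shift_yz !comp_mpolyXU.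
Qed.

End YZPart.

(** * Comparison of both sides at every [q = Q] *)

Theorem theorem1p1 (R : realType) (n k : nat) (hn : (1 <= n)%N) :
  extend_scalars (@laplace R[i] n k) (@bernardi_vec R[i] n k) =
  shift_yz_vec (@bernardi_hat_vec R[i] n k).
Proof.
apply/ffunP=> H; rewrite !ffunE; apply: eq_spec_q => Q.
rewrite spec_q_shift_yz spec_q_yz_part bernardiP shift_yz_part_bernardi_sum.
(* The matrix entries of [laplace] are constants, so [spec_q] passes through them to each [bernardi]
   polynomial. *)
rewrite -laplace_bernardi_sum linear_sum /=; apply: eq_bigr => G _.
by rewrite linearZ ffunE /= bernardiP.
Qed.
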